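(* Let $0<t<1$, let $f$ be a continuous function on $[-1,1]$, and let $s_\ell$ and $s_r$ be infinitely smooth functions on $[-1,t]$ and $[-t,1]$ respectively (approximating $f$ there). Let $s(x)=w_\ell(x)s_\ell(x)+w_r(x)s_r(x)$ for $x\in[-1,1]$. Then $s$ is infinitely smooth on $[-1,1]$ and $$\|f-s\|_{L_\infty[-1,1]}\le\max\left(\|f-s_\ell\|_{L_\infty[-1,t]},\ \|f-s_r\|_{L_\infty[-t,1]}\right).$$
   Context: Let $\psi(x)=\exp\left(1-\frac{1}{1-x^2}\right)$ for $|x|<1$ and $\psi(x)=0$ for $|x|\ge 1$. Put $\psi_\ell(x)=\psi\left(\frac{x+1}{1+t}\right)$, $\psi_r(x)=\psi\left(\frac{x-1}{1+t}\right)$, and for $x\in[-1,1]$ $$w_\ell(x)=\frac{\psi_\ell(x)}{\psi_\ell(x)+\psi_r(x)},\qquad w_r(x)=\frac{\psi_r(x)}{\psi_\ell(x)+\psi_r(x)}.$$ The functions $w_\ell,w_r$ have support on $[-1,t]$ and $[-t,1]$ respectively, and the terms $w_\ell s_\ell$ and $w_r s_r$ are understood to be $0$ outside these intervals. *)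

(* Defs.v *)
From HB Require Import structures.
From mathcomp Require Import all_boot all_order all_algebra.
From mathcomp Require Import all_classical all_reals all_analysis.
Set Implicit Arguments.
Unset Strict Implicit.
Unset Printing Implicit Defensive.
Import Order.TTheory GRing.Theory Num.Theory.
Import numFieldNormedType.Exports.
Local Open Scope classical_set_scope.
Local Open Scope ring_scope.

(* Infinite smoothness relative to D: [d n] is the n-th derivative of [f], the
   difference quotients being taken inside D only, so that derivatives at the
   end points of a closed interval are one-sided. Nothing is required of [f]
   outside D. *)
Definition smooth_on (R : realType) (D : set R) (f : R -> R) : Prop :=
  exists d : nat -> R -> R,
    {in D, d 0%N =1 f} /\
    forall (n : nat) (x : R), D x ->
      (d n y - d n x) / (y - x) @[y --> within D x^'] --> d n.+1 x.

Definition Linfty_norm (R : realType) (a b : R) (g : R -> R) : \bar R :=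
  Lnorm (mrestr (@lebesgue_measure R) (measurable_itv `[a, b])) +oo%E
    (EFin \o g).

Definition bump (R : realType) (x : R) : R :=
  if `|x| < 1 then expR (1 - (1 - x ^+ 2)^-1) else 0.

Definition psi_l (R : realType) (t x : R) : R := bump ((x + 1) / (1 + t)).

Definition psi_r (R : realType) (t x : R) : R := bump ((x - 1) / (1 + t)).

Definition w_l (R : realType) (t x : R) : R :=
  psi_l t x / (psi_l t x + psi_r t x).

Definition w_r (R : realType) (t x : R) : R :=
  psi_r t x / (psi_l t x + psi_r t x).

(* The values of [sl] outside [-1, t] and of [sr] outside [-t, 1] play no
   role. *)
Definition blend (R : realType) (t : R) (sl sr : R -> R) (x : R) : R :=
  (if -1 <= x <= t then w_l t x * sl x else 0) +
  (if - t <= x <= 1 then w_r t x * sr x else 0).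

(* Main.v *)
Require Import Defs.
From mathcomp Require Import all_boot all_order all_algebra.
From mathcomp Require Import all_classical all_reals all_analysis.
From mathcomp Require Import ess_sup_inf ring lra.
Import Order.TTheory GRing.Theory Num.Theory.
Import numFieldNormedType.Exports.
Local Open Scope classical_set_scope.
Local Open Scope ring_scope.

(** Write [s] for [blend t sl sr]. The two assertions rest on different
    properties of the weights.

    For the error bound, [w_l] and [w_r] are nonnegative, add up to 1 on
    [-1, 1] and vanish where the corresponding [sl] or [sr] is cut off, so
    [f - s] is at every point a convex combination of those of [f - sl] and
    [f - sr] that are available there ([blend_error_le]). A bound that holds
    almost everywhere for each of these therefore holds almost everywhere for
    [f - s].

    For smoothness, the only doubtful points are [t] and [-t], where a piece is
    extended by zero. There every derivative of the weight is zero, so by the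
    Leibniz formula every derivative of the product is zero too, and the
    extension is smooth ([smooth_cutoff]).

    The derivatives are handled as whole sequences, called jets: a smooth
    function is the head of a jet. Sums, products and quotients of jets are
    jets, given by explicit recursions from which one reads off that a
    numerator that vanishes to infinite order at a point passes this on
    ([leibniz0l], [quotient_jet0]). The bump function itself is, by partial
    fractions in the exponent, a constant times a product of two copies of
    [exp (- 1 / y)], extended by zero to [y <= 0], composed with affine maps
    ([bump_flat_exp]); the derivatives of that function are of the form
    [p (1 / y) * exp (- 1 / y)] with [p] a polynomial ([is_derive_flat_exp]). *)

Set Implicit Arguments.
Unset Strict Implicit.

(** * Derivatives relative to a set *)

Definition diff_at (R : realType) (D : set R) (f : R -> R) (x l : R) : Prop :=
  (f y - f x) / (y - x) @[y --> within D x^'] --> l.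

Lemma cvg_within_eq (R : realType) (D : set R) (f g : R -> R) (x l m : R) :
  (forall y, D y -> y != x -> f y = g y) -> l = m ->
  f y @[y --> within D x^'] --> l -> g y @[y --> within D x^'] --> m.
Proof.
move=> fg <-; apply: cvg_trans; apply: near_eq_cvg.
by rewrite !near_withinE; apply: nearW => y yx Dy; exact: fg.
Qed.

Lemma cvg_within_dnbhs (R : realType) (D : set R) (f : R -> R) (x l : R) :
  f y @[y --> x] --> l -> f y @[y --> within D x^'] --> l.
Proof.
move=> fl; apply: cvg_within_filter; apply: cvg_trans fl; apply: cvg_app.
exact: nbhs_dnbhs.
Qed.

Lemma diff_at_congr (R : realType) (D : set R) (f g : R -> R) (x l : R) :
  D x -> (forall y, D y -> f y = g y) -> diff_at D f x l -> diff_at D g x l.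
Proof.
by move=> Dx fg; apply: cvg_within_eq => // y Dy _; rewrite !fg.
Qed.

Lemma diff_at_cst (R : realType) (D : set R) (c x : R) :
  diff_at D (fun=> c) x 0.
Proof.
rewrite /diff_at; under eq_fun do rewrite subrr mul0r.
exact: cvg_cst.
Qed.

Lemma diff_at_cvg (R : realType) (D : set R) (f : R -> R) (x l : R) :
  diff_at D f x l -> f y @[y --> within D x^'] --> f x.
Proof.
move=> fl.
have idx : (y - x) @[y --> within D x^'] --> x - x.
  apply: cvg_within_dnbhs; exact: (cvgB cvg_id (cvg_cst x)).
apply: (cvg_within_eq _ _ (cvgD (cvgM fl idx) (cvg_cst (f x)))) => [y _ yx|].
  by rewrite /= divfK ?subr_eq0// subrK.
by rewrite subrr mulr0 add0r.
Qed.

Lemma diff_atD (R : realType) (D : set R) (f g : R -> R) (x l m : R) :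
  diff_at D f x l -> diff_at D g x m ->
  diff_at D (fun y => f y + g y) x (l + m).
Proof.
move=> fl gm; apply: (cvg_within_eq _ _ (cvgD fl gm)) => // y _ _ /=; ring.
Qed.

Lemma diff_atM (R : realType) (D : set R) (f g : R -> R) (x l m : R) :
  diff_at D f x l -> diff_at D g x m ->
  diff_at D (fun y => f y * g y) x (l * g x + f x * m).
Proof.
move=> fl gm.
apply: (cvg_within_eq _ _ (cvgD (cvgM fl (diff_at_cvg gm))
                                (cvgM (cvg_cst (f x)) gm))) => // y _ _ /=.
ring.
Qed.

Lemma diff_atZ (R : realType) (D : set R) (c : R) (f : R -> R) (x l : R) :
  diff_at D f x l -> diff_at D (fun y => c * f y) x (c * l).
Proof.
by move=> fl; have := diff_atM (diff_at_cst D c x) fl; rewrite mul0r add0r.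
Qed.

Lemma diff_atX (R : realType) (D : set R) (f : R -> R) (x l : R) (n : nat) :
  diff_at D f x l ->
  diff_at D (fun y => f y ^+ n.+1) x (n.+1%:R * f x ^+ n * l).
Proof.
move=> fl; elim: n => [|n IHn]; first by rewrite expr0 !mul1r.
have := diff_atM fl IHn; congr (diff_at _ _ _ _).
by rewrite exprS -[in RHS]natr1; ring.
Qed.

Lemma diff_atV (R : realType) (D : set R) (f : R -> R) (x l : R) :
  D x -> (forall y, D y -> f y != 0) -> diff_at D f x l ->
  diff_at D (fun y => (f y)^-1) x (- (l / f x ^+ 2)).
Proof.
move=> Dx f0 fl.
have fV : (f y)^-1 @[y --> within D x^'] --> (f x)^-1.
  exact: (cvgV (f0 x Dx) (diff_at_cvg fl)).
apply: (cvg_within_eq _ _ (cvgN (cvgM fl (cvgM fV (cvg_cst (f x)^-1))))).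
  by move=> y Dy yx /=; field; rewrite subr_eq0 yx !f0.
by rewrite -invfM -expr2.
Qed.

Lemma diff_at_is_derive (R : realType) (D : set R) (f : R -> R) (x l : R) :
  is_derive x 1 f l -> diff_at D f x l.
Proof.
move=> /is_derive1_caratheodory[g [fg cg <-]].
have : g y @[y --> within D x^'] --> g x.
  exact: cvg_within_dnbhs.
by apply: cvg_within_eq => // y _ yx; rewrite fg mulfK ?subr_eq0.
Qed.

(** Away from a closed set [A] the filter is improper, hence every [l] is a
    limit. *)
Lemma diff_at_notin (R : realType) (A : set R) (f : R -> R) (x l : R) :
  closed A -> ~ A x -> diff_at A f x l.
Proof.
move=> Acl Ax P _.
have nA : \forall y \near x^', ~ A y.
  apply: nbhs_dnbhs; apply: (@open_nbhs_nbhs _ x (~` A)); split; last exact: Ax.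
  exact: closed_openC.
by apply: (filterS _ nA) => y /= nAy Ay.
Qed.

Lemma diff_atU (R : realType) (A B D : set R) (f : R -> R) (x l : R) :
  D `<=` A `|` B -> diff_at A f x l -> diff_at B f x l -> diff_at D f x l.
Proof.
move=> DAB fA fB P Pl; move: (fA P Pl) (fB P Pl).
by apply: (@filterS2 _ x^') => y /= PA PB /DAB[/PA|/PB].
Qed.

(** * Sequences of successive derivatives *)

Definition jet (R : realType) (D : set R) (d : nat -> R -> R) : Prop :=
  forall n x, D x -> diff_at D (d n) x (d n.+1 x).

Lemma diff_at_sub (R : realType) (A D : set R) (f : R -> R) (x l : R) :
  A `<=` D -> diff_at D f x l -> diff_at A f x l.
Proof.
by move=> AD fD P Pl; have := fD P Pl; apply: (@filterS _ x^') => y PD /AD.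
Qed.

Lemma jet_sub (R : realType) (A D : set R) (d : nat -> R -> R) :
  A `<=` D -> jet D d -> jet A d.
Proof. by move=> AD dD n x /AD Dx; apply: (diff_at_sub AD); exact: dD. Qed.

Lemma jetD (R : realType) (D : set R) (a b : nat -> R -> R) :
  jet D a -> jet D b -> jet D (fun n x => a n x + b n x).
Proof. by move=> ja jb n x Dx; apply: diff_atD; [exact: ja|exact: jb]. Qed.

Lemma jetZ (R : realType) (D : set R) (c : R) (a : nat -> R -> R) :
  jet D a -> jet D (fun n x => c * a n x).
Proof. by move=> ja n x Dx; apply: diff_atZ; exact: ja. Qed.

Definition shift_jet (R : realType) (d : nat -> R -> R) : nat -> R -> R :=
  fun n => d n.+1.

(** The [n]-th derivative of a product, with the binomial sum replaced by the
    recursion [(ab)^(n+1) = (a'b)^(n) + (ab')^(n)], which makes [jetM] an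
    induction without any reindexing. *)
Fixpoint leibniz (R : realType) (a b : nat -> R -> R) (n : nat) (x : R) : R :=
  if n is m.+1 then leibniz (shift_jet a) b m x + leibniz a (shift_jet b) m x
  else a 0%N x * b 0%N x.

Lemma jetM (R : realType) (D : set R) (a b : nat -> R -> R) :
  jet D a -> jet D b -> jet D (leibniz a b).
Proof.
move=> ja jb n; elim: n a b ja jb => [|n IHn] a b ja jb x Dx /=.
  by apply: diff_atM; [exact: ja|exact: jb].
apply: diff_atD.
  by apply: (IHn (shift_jet a) b) => // k y Dy; exact: ja.
by apply: (IHn a (shift_jet b)) => // k y Dy; exact: jb.
Qed.

Lemma leibniz0l (R : realType) (a b : nat -> R -> R) (n : nat) (x : R) :
  (forall k, a k x = 0) -> leibniz a b n x = 0.
Proof.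
elim: n a b => [|n IHn] a b a0 /=; first by rewrite a0 mul0r.
by rewrite !IHn ?addr0 => // k; exact: a0.
Qed.

Lemma leibniz0r (R : realType) (a b : nat -> R -> R) (n : nat) (x : R) :
  (forall k, b k x = 0) -> leibniz a b n x = 0.
Proof.
elim: n a b => [|n IHn] a b b0 /=; first by rewrite b0 mulr0.
by rewrite !IHn ?addr0 => // k; exact: b0.
Qed.

(** The [n]-th derivative of [a / d] is written [c_n / d ^ n.+1], which forces
    [c_(n+1) = c_n' d - (n + 1) c_n d']. Each numerator [c_n] is kept with all
    its derivatives, indexed by the second argument. *)
Fixpoint quotient_num (R : realType) (a d : nat -> R -> R) (n : nat) :
    nat -> R -> R :=
  if n is m.+1 then fun k x =>
    leibniz (shift_jet (quotient_num a d m)) d k x +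
    - m.+1%:R * leibniz (quotient_num a d m) (shift_jet d) k x
  else a.

Definition quotient_jet (R : realType) (a d : nat -> R -> R) (n : nat) (x : R)
  : R := quotient_num a d n 0%N x / d 0%N x ^+ n.+1.

Lemma jet_quotient_num (R : realType) (D : set R) (a d : nat -> R -> R) n :
  jet D a -> jet D d -> jet D (quotient_num a d n).
Proof.
move=> ja jd; elim: n => [//|n IHn] /=.
apply: jetD; first by apply: jetM => // k x Dx; exact: IHn.
by apply: jetZ; apply: jetM => // k x Dx; exact: jd.
Qed.

Lemma jet_quotient (R : realType) (D : set R) (a d : nat -> R -> R) :
  (forall x, D x -> d 0%N x != 0) -> jet D a -> jet D d ->
  jet D (quotient_jet a d).
Proof.
move=> d0 ja jd n x Dx; rewrite /quotient_jet.
have num : diff_at D (quotient_num a d n 0%N) x (quotient_num a d n 1%N x).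
  exact: jet_quotient_num.
have den := @diff_atX _ _ _ _ _ n (jd 0%N x Dx).
have dn y : D y -> d 0%N y ^+ n.+1 != 0 by move=> Dy; rewrite expf_neq0 ?d0.
have := diff_atM num (diff_atV Dx dn den); congr (diff_at _ _ _ _).
rewrite /= /shift_jet -natr1 !exprS.
have dx0 := d0 x Dx; have dnx0 : d 0%N x ^+ n != 0 by rewrite expf_neq0.
field.
by rewrite dx0 dnx0.
Qed.

Lemma quotient_num0 (R : realType) (a d : nat -> R -> R) (x : R) :
  (forall k, a k x = 0) -> forall n k, quotient_num a d n k x = 0.
Proof.
move=> a0; elim=> [//|n IHn] k /=.
by rewrite !leibniz0l ?mulr0 ?addr0// => j; exact: IHn.
Qed.

Lemma quotient_jet0 (R : realType) (a d : nat -> R -> R) (n : nat) (x : R) :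
  (forall k, a k x = 0) -> quotient_jet a d n x = 0.
Proof. by move=> a0; rewrite /quotient_jet quotient_num0 ?mul0r. Qed.

(** * The flat exponential and the bump function *)

Definition flat_exp (R : realType) (p : {poly R}) (y : R) : R :=
  if 0 < y then p.[y^-1] * expR (- y^-1) else 0.

(** One term of the exponential series, the one of degree [n.+1], already
    gives the bound. *)
Lemma expRN_leX (R : realType) (n : nat) (z : R) :
  0 < z -> z ^+ n * expR (- z) <= n.+1`!%:R / z.
Proof.
move=> z0; rewrite ler_pdivlMr// mulrAC -exprSr expRN.
rewrite ler_pdivrMr ?expR_gt0// -ler_pdivrMl ?ltr0n ?fact_gt0//.
rewrite mulrC (le_trans _ (expR_ge1Dxn n (ltW z0)))//.
by rewrite lerDr.
Qed.

(** This linear bound gives the derivative at 0: the difference quotient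
    of [flat_exp p] there is [flat_exp ('X * p)]. *)
Lemma flat_exp_le (R : realType) (p : {poly R}) :
  exists C, forall y, `|flat_exp p y| <= C * `|y|.
Proof.
exists (\sum_(i < size p) `|p`_i| * (i.+1)`!%:R) => y; rewrite /flat_exp.
case: ifPn => [y0|_]; last first.
  by rewrite normr0 mulr_ge0// sumr_ge0// => i _; rewrite mulr_ge0.
rewrite (gtr0_norm y0) normrM (gtr0_norm (expR_gt0 _)) horner_coef.
rewrite (le_trans (ler_wpM2r (expR_ge0 _) (ler_norm_sum _ _ _)))//.
rewrite !mulr_suml ler_sum// => i _; rewrite normrM -!mulrA ler_wpM2l//.
rewrite ger0_norm ?exprn_ge0 ?invr_ge0 ?(ltW y0)//.
by have := @expRN_leX R i y^-1; rewrite invr_gt0 invrK; apply.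
Qed.

(** With [z = 1 / y] one has [dz / dy = - z ^ 2], and differentiating
    [p(z) * exp (- z)] yields [z ^ 2 * (p(z) - p'(z)) * exp (- z)]. *)
Definition flat_next (R : realType) (p : {poly R}) : {poly R} :=
  'X ^+ 2 * (p - p^`()).

Lemma is_derive_flat_exp (R : realType) (p : {poly R}) (x : R) :
  is_derive x 1 (flat_exp p) (flat_exp (flat_next p) x).
Proof.
have [x0|x0|->] := ltgtP x 0.
- have -> : flat_exp (flat_next p) x = 0 by rewrite /flat_exp ltNge (ltW x0).
  apply: (@near_eq_is_derive _ _ _ (fun=> 0)).
  near=> y; have y0 : y < 0 by near: y; exact: lt_nbhsl.
  by rewrite /flat_exp ltNge (ltW y0).
- rewrite [X in is_derive _ _ _ X]/flat_exp x0.
  have dV : is_derive x 1 (fun y : R => y^-1) (- (x ^- 2)).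
    have := @is_deriveV R id x 1 1 _ (is_derive_id _ _).
    by rewrite gt_eqF// => /(_ isT); rewrite /GRing.scale/= mulr1.
  have dp := is_derive1_comp (is_derive_poly p x^-1) dV.
  have de := @is_derive1_comp R expR (fun y => - y^-1) x _ _
    (is_derive_expR (- x^-1)) (is_deriveN dV).
  have dpe : is_derive x 1 (fun y => p.[y^-1] * expR (- y^-1))
      ((flat_next p).[x^-1] * expR (- x^-1)).
    apply: (is_derive_eq (is_deriveM dp de)).
    rewrite /GRing.scale/= /flat_next !hornerE/=; rewrite -exprVn; ring.
  apply: (near_eq_is_derive _ dpe); near=> y.
  have y0 : 0 < y by near: y; exact: lt_nbhsr.
  by rewrite /flat_exp y0.
- have -> : flat_exp (flat_next p) 0 = 0 by rewrite /flat_exp ltxx.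
  apply/is_derive1_caratheodory.
  exists (flat_exp ('X * p)); split.
  + move=> z; rewrite /flat_exp ltxx !subr0.
    case: ifPn => z0; last by rewrite mul0r.
    by rewrite hornerM hornerX; field; rewrite gt_eqF.
  + have [C hC] := flat_exp_le ('X * p).
    apply/continuous_withinNx; rewrite [X in _ --> X]/flat_exp ltxx.
    by apply: (@cvg_to_0_linear _ _ C 1) => // r _; exact: hC.
  + by rewrite /flat_exp ltxx.
Unshelve. all: by end_near. Qed.

Lemma flat_exp_affine_jet (R : realType) (D : set R) (p : {poly R}) (a b : R) :
  jet D (fun n x => a ^+ n * flat_exp (iter n (@flat_next R) p) (a * x + b)).
Proof.
move=> n x Dx; rewrite exprSr -mulrA; apply: diff_atZ.
apply: diff_at_is_derive; rewrite mulrC.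
have := @is_derive1_comp R _ (fun y => a * y + b) x _ a
  (is_derive_flat_exp (iter n (@flat_next R) p) _).
apply; apply: (is_derive_eq (is_deriveD (is_deriveZ a (is_derive_id x 1))
                                        (is_derive_cst b x 1))).
by rewrite addr0 /GRing.scale/= mulr1.
Qed.

(** Since [1 / (1 - x ^ 2) = 1 / (2 (1 - x)) + 1 / (2 (1 + x))], the bump
    function splits into factors whose arguments are affine in [x], and the
    only chain rule that enters is the affine one. *)
Lemma bump_flat_exp (R : realType) (x : R) :
  Defs.bump x = expR 1 * (flat_exp 1 (2 * (1 - x)) * flat_exp 1 (2 * (1 + x))).
Proof.
rewrite /Defs.bump /flat_exp !pmulr_rgt0// ltr_norml subr_gt0.
have -> : (0 < 1 + x) = (-1 < x) by rewrite -[in RHS]subr_gt0 opprK addrC.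
have [xN1|xN1] := ltP (-1) x; last by rewrite !mulr0.
have [x1|x1] := ltP x 1; last by rewrite mul0r mulr0.
have one_horner z : (1 : {poly R}).[z] = 1 by rewrite hornerE.
rewrite /= !one_horner !mul1r -!expRD; congr expR.
field; apply/and3P; split; rewrite gt_eqF//; nra.
Qed.

(** Outside the open support one of the two factors has a nonpositive argument,
    so all its derivatives are zero there, and so are those of the product. *)
Lemma bump_affine_jet (R : realType) (a b : R) :
  exists d : nat -> R -> R,
    [/\ forall D, jet D d, forall x, d 0%N x = Defs.bump (a * x + b) &
        forall n x, 1 <= `|a * x + b| -> d n x = 0].
Proof.
pose u := fun n x => (- 2 * a) ^+ n *
  flat_exp (iter n (@flat_next R) 1) ((- 2 * a) * x + 2 * (1 - b)).
pose v := fun n x => (2 * a) ^+ n *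
  flat_exp (iter n (@flat_next R) 1) ((2 * a) * x + 2 * (1 + b)).
exists (fun n x => expR 1 * leibniz u v n x); split.
- move=> D; apply: jetZ.
  by apply: jetM => n x Dx; exact: flat_exp_affine_jet.
- move=> x; rewrite bump_flat_exp /= /u /v !expr0 !mul1r /=.
  by congr (_ * (flat_exp _ _ * flat_exp _ _)); ring.
- move=> n x; rewrite ler_normr => /orP[|] abx.
  + rewrite leibniz0l ?mulr0// => k; rewrite /u /flat_exp ifN ?mulr0// -leNgt.
    by lra.
  + rewrite leibniz0r ?mulr0// => k; rewrite /v /flat_exp ifN ?mulr0// -leNgt.
    by lra.
Qed.

(** * Extension by zero *)

Lemma jet_smooth (R : realType) (D : set R) (d : nat -> R -> R) (f : R -> R) :
  jet D d -> (forall x, D x -> d 0%N x = f x) -> smooth_on D f.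
Proof. by move=> jd d0; exists d; split => // x; rewrite inE => /d0. Qed.

Lemma smooth_jet (R : realType) (D : set R) (f : R -> R) :
  smooth_on D f ->
  exists2 d, jet D d & forall x, D x -> d 0%N x = f x.
Proof. by move=> [d [d0 jd]]; exists d => // x Dx; apply: d0; rewrite inE. Qed.

(** A limit within [D] follows from the limits within the closed sets [A] and
    [B], and at a point of only one of them the other one imposes nothing. *)
Lemma jet_glue0 (R : realType) (A B D : set R) (a : nat -> R -> R) :
  closed A -> closed B -> D `<=` A `|` B -> jet A a ->
  (forall n x, A x -> B x -> a n x = 0) ->
  jet D (fun n x => if x \in A then a n x else 0).
Proof.
move=> Acl Bcl DAB ja aB0 n x Dx; apply: (diff_atU DAB).
  have [Ax|nAx] := pselect (A x); last exact: diff_at_notin.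
  rewrite mem_set//; apply: diff_at_congr (ja n x Ax) => // y Ay.
  by rewrite mem_set.
have [Bx|nBx] := pselect (B x); last exact: diff_at_notin.
have zero k y : B y -> (if y \in A then a k y else 0) = 0.
  by move=> By; case: ifPn => //; rewrite inE => Ay; exact: aB0.
rewrite zero//; apply: diff_at_congr (diff_at_cst B 0 x) => // y By.
by rewrite zero.
Qed.

Lemma smooth_cutoff (R : realType) (A B D : set R) (w : nat -> R -> R)
    (s : R -> R) :
  closed A -> closed B -> D `<=` A `|` B -> A `<=` D ->
  jet D w -> (forall n x, B x -> w n x = 0) -> smooth_on A s ->
  smooth_on D (fun x => if x \in A then w 0%N x * s x else 0).
Proof.
move=> Acl Bcl DAB AD jw wB0 /smooth_jet[d jd d0].
apply: (@jet_smooth _ _ (fun n x => if x \in A then leibniz w d n x else 0)).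
  apply: (jet_glue0 Acl Bcl DAB); first by apply: jetM => //; exact: jet_sub jw.
  by move=> n x _ Bx; apply: leibniz0l => k; exact: wB0.
by move=> x _; case: ifPn => //; rewrite inE => Ax /=; rewrite d0.
Qed.

Lemma smoothD (R : realType) (D : set R) (f g : R -> R) :
  smooth_on D f -> smooth_on D g -> smooth_on D (fun x => f x + g x).
Proof.
move=> /smooth_jet[a ja a0] /smooth_jet[b jb b0].
by apply: (jet_smooth (jetD ja jb)) => x Dx; rewrite a0// b0.
Qed.

(** * The weights and the blend *)

Lemma bump_ge0 (R : realType) (x : R) : 0 <= Defs.bump x.
Proof. by rewrite /Defs.bump; case: ifP => // _; exact: expR_ge0. Qed.

Lemma bump_gt0 (R : realType) (x : R) : `|x| < 1 -> 0 < Defs.bump x.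
Proof. by rewrite /Defs.bump => ->; exact: expR_gt0. Qed.

Lemma bump_eq0 (R : realType) (x : R) : 1 <= `|x| -> Defs.bump x = 0.
Proof. by rewrite /Defs.bump leNgt => /negbTE ->. Qed.

Lemma psi_sum_gt0 (R : realType) (t x : R) :
  0 < t -> -1 <= x <= 1 -> 0 < psi_l t x + psi_r t x.
Proof.
move=> t0 /andP[xN1 x1]; rewrite /psi_l /psi_r.
have t1 : 0 < 1 + t by lra.
have [xlt|xgt] := ltP x t.
  rewrite ltr_wpDr ?bump_ge0// bump_gt0// ltr_norml.
  by rewrite ltr_pdivlMr// ltr_pdivrMr//; lra.
rewrite ltr_wpDl ?bump_ge0// bump_gt0// ltr_norml.
by rewrite ltr_pdivlMr// ltr_pdivrMr//; lra.
Qed.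

Lemma psi_l_eq0 (R : realType) (t x : R) : 0 < t -> t <= x -> psi_l t x = 0.
Proof.
move=> t0 tx; rewrite /psi_l bump_eq0// ler_normr ler_pdivlMr; lra.
Qed.

Lemma psi_r_eq0 (R : realType) (t x : R) : 0 < t -> x <= - t -> psi_r t x = 0.
Proof.
move=> t0 tx; rewrite /psi_r bump_eq0// ler_normr -mulNr !ler_pdivlMr; lra.
Qed.

Lemma smooth_blend (R : realType) (t : R) (sl sr : R -> R) :
  0 < t -> t < 1 -> smooth_on `[-1, t] sl -> smooth_on `[- t, 1] sr ->
  smooth_on `[-1, 1] (blend t sl sr).
Proof.
move=> t0 t1 sls srs; have u0 : 0 < 1 + t by lra.
have [l [jl lE l0]] := bump_affine_jet (1 + t)^-1 (1 + t)^-1.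
have [r [jr rE r0]] := bump_affine_jet (1 + t)^-1 (- (1 + t)^-1).
have {}lE x : l 0%N x = psi_l t x by rewrite lE; congr Defs.bump; field; lra.
have {}rE x : r 0%N x = psi_r t x by rewrite rE; congr Defs.bump; field; lra.
pose D : set R := `[-1, 1]%classic; pose s := fun n x => l n x + r n x.
have s0 x : D x -> s 0%N x != 0.
  rewrite /D/= in_itv/= => Dx.
  by rewrite /s lE rE gt_eqF// psi_sum_gt0.
have js : jet D s by exact: jetD.
have jwl := jet_quotient s0 (jl D) js.
have jwr := jet_quotient s0 (jr D) js.
have wl0 n x : `[t, 1]%classic x -> quotient_jet l s n x = 0.
  rewrite /= in_itv/= => /andP[tx _]; apply: quotient_jet0 => k; apply: l0.
  have -> : (1 + t)^-1 * x + (1 + t)^-1 = (x + 1) / (1 + t) by ring.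
  rewrite ler_normr ler_pdivlMr; lra.
have wr0 n x : `[-1, - t]%classic x -> quotient_jet r s n x = 0.
  rewrite /= in_itv/= => /andP[_ xt]; apply: quotient_jet0 => k; apply: r0.
  have -> : (1 + t)^-1 * x - (1 + t)^-1 = (x - 1) / (1 + t) by ring.
  rewrite ler_normr -mulNr !ler_pdivlMr; lra.
have Dl : D `<=` `[-1, t]%classic `|` `[t, 1]%classic.
  by move=> x; rewrite /D/= !in_itv/= => /andP[? ?]; case: (leP x t) => ?; lra.
have Dr : D `<=` `[- t, 1]%classic `|` `[-1, - t]%classic.
  move=> x; rewrite /D/= !in_itv/= => /andP[? ?].
  by case: (leP x (- t)) => ?; lra.
have lD : `[-1, t]%classic `<=` D by move=> x; rewrite /D/= !in_itv/=; lra.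
have rD : `[- t, 1]%classic `<=` D by move=> x; rewrite /D/= !in_itv/=; lra.
have sml := smooth_cutoff (@itv_closed _ _ _ _) (@itv_closed _ _ _ _)
  Dl lD jwl wl0 sls.
have smr := smooth_cutoff (@itv_closed _ _ _ _) (@itv_closed _ _ _ _)
  Dr rD jwr wr0 srs.
have := smoothD sml smr; congr smooth_on; apply/funext => x.
rewrite /blend !mem_setE !in_itv/= /quotient_jet/= /s !lE !rE !expr1.
by [].
Qed.

(** * The error bound *)

Lemma ae_mrestr (d : measure_display) (T : measurableType d) (R : realType)
    (mu : {measure set T -> \bar R}) (D : set T) (mD : measurable D)
    (P : T -> Prop) :
  (\forall x \ae mrestr mu mD, P x) <-> (\forall x \ae mu, D x -> P x).
Proof.
split=> [[N [mN N0 PN]]|[N [mN N0 PN]]].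
  exists (N `&` D); split => //; first exact: measurableI.
  by move=> x /= /not_implyP[Dx nPx]; split => //; exact: PN.
exists (N `|` ~` D); split.
- by apply: measurableU => //; exact: measurableC.
- rewrite /mrestr setIUl setICl setU0.
  apply: (subset_measure0 _ _ _ N0) => //.
  exact: measurableI.
- move=> x /= nPx; have [Dx|nDx] := pselect (D x); last by right.
  by left; apply: PN => /= h; apply: nPx; exact: h.
Qed.

(** Put into the context below as a local instance for [filterS]. *)
Lemma ae_filter_lebesgue (R : realType) :
  Filter (almost_everywhere (@lebesgue_measure R)).
Proof. exact: ae_filter_ringOfSetsType. Qed.

(** On an interval of positive length the norm is an essential supremum, and
    not the value 0 that it has by convention on a null space. *)
Lemma Linfty_norm_ge (R : realType) (a b : R) (g : R -> R) : a < b ->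
  \forall x \ae @lebesgue_measure R,
    a <= x <= b -> (`|g x|%:E <= Linfty_norm a b g)%E.
Proof.
move=> ab; rewrite /Linfty_norm unlock /Lnorm ifT.
  have /ae_mrestr := @ess_sup_ge _ _ _ (mrestr (@lebesgue_measure R)
    (measurable_itv `[a, b])) (abse \o (EFin \o g)).
  by move=> gle; apply: (filterS _ gle) => x; rewrite /= in_itv.
rewrite [X in (_ < X)%E](_ : _ = lebesgue_measure `[a, b]%classic).
  by rewrite lebesgue_measure_itv/= lte_fin ab -EFinB lte_fin subr_gt0.
by rewrite -[RHS](congr1 _ (setTI `[a, b]%classic)).
Qed.

Lemma Linfty_norm_le (R : realType) (a b : R) (g : R -> R) (M : \bar R) :
  (0 <= M)%E ->
  (\forall x \ae @lebesgue_measure R, a <= x <= b -> (`|g x|%:E <= M)%E) ->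
  (Linfty_norm a b g <= M)%E.
Proof.
move=> M0 gM; rewrite /Linfty_norm unlock /Lnorm; case: ifPn => // _.
have aeF := ae_filter_lebesgue R.
apply/ess_supP/ae_mrestr; apply: (filterS _ gM) => x.
by rewrite /= in_itv.
Qed.

(** Where a piece is cut off its weight is zero, so in all cases
    [`|w * f - piece| <= w * M], and the weights add up to 1. *)
Lemma blend_error_le (R : realType) (t : R) (f sl sr : R -> R) (M x : R) :
  0 < t -> t < 1 -> -1 <= x <= 1 ->
  (-1 <= x <= t -> `|f x - sl x| <= M) ->
  (- t <= x <= 1 -> `|f x - sr x| <= M) ->
  `|f x - blend t sl sr x| <= M.
Proof.
move=> t0 t1 x1 flM frM; have s0 := psi_sum_gt0 t0 x1.
have wl0 : 0 <= w_l t x by rewrite divr_ge0 ?bump_ge0// ltW.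
have wr0 : 0 <= w_r t x by rewrite divr_ge0 ?bump_ge0// ltW.
have w1 : w_l t x + w_r t x = 1 by rewrite -mulrDl divff// gt_eqF.
set cl := if -1 <= x <= t then w_l t x * sl x else 0.
set cr := if - t <= x <= 1 then w_r t x * sr x else 0.
have el : `|w_l t x * f x - cl| <= w_l t x * M.
  rewrite /cl; case: ifPn => [/flM|xt].
    by move=> flM'; rewrite -mulrBr normrM ger0_norm// ler_wpM2l.
  rewrite /w_l psi_l_eq0// ?mul0r ?subr0 ?normr0// ltW//; lra.
have er : `|w_r t x * f x - cr| <= w_r t x * M.
  rewrite /cr; case: ifPn => [/frM|xt].
    by move=> frM'; rewrite -mulrBr normrM ger0_norm// ler_wpM2l.
  rewrite /w_r psi_r_eq0// ?mul0r ?subr0 ?normr0// ltW//; lra.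
have -> : f x - blend t sl sr x =
    (w_l t x * f x - cl) + (w_r t x * f x - cr).
  by rewrite /blend -/cl -/cr -[in LHS](mul1r (f x)) -w1; ring.
rewrite (le_trans (ler_normD _ _))// (le_trans (lerD el er))//.
by rewrite -mulrDl w1 mul1r.
Qed.

Unset Implicit Arguments.
Set Strict Implicit.

Theorem mainTheorem3 (R : realType) (t : R) (f sl sr : R -> R)
  (t_gt0 : 0 < t) (t_lt1 : t < 1)
  (f_cont : {within `[-1, 1], continuous f})
  (sl_smooth : smooth_on `[-1, t] sl)
  (sr_smooth : smooth_on `[- t, 1] sr) :
  smooth_on `[-1, 1] (blend t sl sr) /\
  (Linfty_norm (-1) 1 (f \- blend t sl sr)%R <=
     Order.max (Linfty_norm (-1) t (f \- sl)%R)
               (Linfty_norm (- t) 1 (f \- sr)%R))%E.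
Proof.
split; first exact: smooth_blend.
set M := Order.max _ _; have aeF := ae_filter_lebesgue R.
have Nl : \forall x \ae @lebesgue_measure R,
    -1 <= x <= t -> (`|f x - sl x|%:E <= M)%E.
  have lt1 : -1 < t by lra.
  apply: (filterS _ (Linfty_norm_ge (f \- sl) lt1)) => x.
  move=> /[apply] /le_trans; apply.
  by rewrite le_max lexx.
have Nr : \forall x \ae @lebesgue_measure R,
    - t <= x <= 1 -> (`|f x - sr x|%:E <= M)%E.
  have lt1 : - t < 1 by lra.
  apply: (filterS _ (Linfty_norm_ge (f \- sr) lt1)) => x.
  move=> /[apply] /le_trans; apply.
  by rewrite le_max lexx orbT.
have M0 : (0 <= M)%E by rewrite le_max Lnorm_ge0.
apply: Linfty_norm_le => //; move: Nl Nr; apply: filterS2 => x.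
move: M0; case: M => [M _|_ _ _ _|//]; last exact: leey.
by rewrite !lee_fin => flM frM x1; exact: blend_error_le.
Qed.
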